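(* For every uncountable cardinal $\kappa\le\mathfrak{c}$, the following statements are equivalent: (1) there is a meager in itself countable dense homogeneous (separable) metric space of size $\kappa$; (2) there is a $\lambda$-set of size $\kappa$.
   Context: $\mathfrak{c}=2^{\aleph_0}$. A separable topological space $X$ is countable dense homogeneous (CDH) if for any two countable dense subsets $D,E$ of $X$ there is a homeomorphism $f\colon X\to X$ with $f[D]=E$; CDH spaces are thus separable by definition. A space is meager in itself if it is a countable union of its nowhere dense subsets. A $\lambda$-set is a subset $X$ of $2^\omega$ such that every countable subset of $X$ is a relative $G_\delta$ subset of $X$; topologically, these are the zero-dimensional separable metrizable spaces in which every countable subset is $G_\delta$. *)

(* Defs.v *)
From mathcomp Require Import all_boot all_order all_algebra.
From mathcomp Require Import all_classical all_reals.
From mathcomp Require Import topology cantor borel_hierarchy.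

Set Implicit Arguments.
Unset Strict Implicit.
Unset Printing Implicit Defensive.

Local Open Scope classical_set_scope.

Section CountableDenseHomogeneity.
Context {X : topologicalType}.

Definition separable : Prop :=
  exists2 D : set X, countable D & dense D.

Definition homeomorphism (f : X -> X) : Prop :=
  exists g : X -> X, [/\ cancel f g, cancel g f, continuous f & continuous g].

Definition countable_dense_homogeneous : Prop :=
  separable /\
  forall D E : set X, countable D -> dense D -> countable E -> dense E ->
    exists2 f : X -> X, homeomorphism f & f @` D = E.

Definition nowhere_dense (A : set X) : Prop := interior (closure A) = set0.

Definition meager_in_itself : Prop :=
  exists2 F : nat -> set X,
    (forall n, nowhere_dense (F n)) & [set: X] = \bigcup_n F n.

End CountableDenseHomogeneity.

Arguments separable X : clear implicits.
Arguments countable_dense_homogeneous X : clear implicits.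
Arguments meager_in_itself X : clear implicits.

Definition lambda_set (X : set cantor_space) : Prop :=
  forall D : set cantor_space, D `<=` X -> countable D ->
    exists2 G : set cantor_space, Gdelta G & D = X `&` G.

(* Main.v *)
Require Import Defs.
From HB Require Import structures.
From mathcomp Require Import all_boot all_order all_algebra.
From mathcomp Require Import all_classical all_reals.
From mathcomp Require Import topology cantor borel_hierarchy.

(* If X is meager in itself and CDH, a dense sequence whose n-th term avoids the
   closures of the first n nowhere dense pieces has a G_delta range, so by
   homogeneity every countable subset of X is G_delta; this property passes to
   the image of X under x |-> (n |-> x in U_n), for a countable base (U_n),
   because the inverse of this injection is continuous.

   Conversely, let X be an uncountable lambda-set.  Take the sequences over a
   countably infinite alphabet of bits and markers that have finitely many
   markers and spell, after the last one, a point of X (each marker prescribes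
   the bits read so far).  With the first-difference ultrametric this space is
   meager in itself and has the size of X.  It is CDH by isometries.  Given D
   and E, cover X by countably many closed sets F_k, each of which is either a
   point spelled by some element of D or E, or contains no such point.  Two
   automata read a point and its image letter by letter, each one following at
   every moment either a single point or the copies of one F_k; a letter that
   leaves the current piece selects a new one.  Markers provide infinitely many
   letters selecting pieces of every kind, so that at every pair of states of
   equal kind some bijection of the alphabet respects the kinds of the next
   states.  Along a point of the space the piece is eventually constant (bits
   select the least F_k compatible with the bits read), so that the image
   spells the same point of X or is the partner of a followed point. *)

Set Implicit Arguments.
Unset Strict Implicit.
Unset Printing Implicit Defensive.

Import Order.TTheory GRing.Theory Num.Theory.

Local Open Scope classical_set_scope.
Local Open Scope card_scope.

(** * Countable sets and prefixes of sequences *)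

Lemma set_inj_card_le (A B : Type) (S : set A) (S' : set B) (f : A -> B) :
  set_fun S S' f -> set_inj S f -> S #<= S'.
Proof.
move=> fS finj; have /injfunPex[g] : exists2 f, set_fun S S' f & set_inj S f.
  by exists f.
exact: inj_card_le.
Qed.

Lemma countableU T (A B : set T) :
  countable A -> countable B -> countable (A `|` B).
Proof.
move=> Ac Bc; rewrite -bigcup2E; apply: bigcup_countable => // i _.
by case: i => [|[|i]] //=.
Qed.

Lemma countable_image (A B : Type) (f : A -> B) (S : set A) :
  countable S -> countable (f @` S).
Proof. exact: sub_countable (card_image_le _ _). Qed.

Lemma ex_invS_lt (R : realType) (e : R) : (0 < e)%R ->
  exists k, (k.+1%:R^-1 < e)%R.
Proof.
move=> e0; exists (Num.trunc e^-1); rewrite -[ltRHS]invrK.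
by rewrite ltf_pV2 ?posrE ?ltr0n ?invr_gt0 // Num.Theory.truncnS_gt.
Qed.

Section Sequences.
Context {T : Type}.
Implicit Types (v w : seq T) (y z : nat -> T).

Definition splice v z : nat -> T :=
  fun n => if n < size v then nth (z 0) v n else z (n - size v).

Lemma mkseq_splice v z : mkseq (splice v z) (size v) = v.
Proof.
apply: (@eq_from_nth _ (z 0)); rewrite size_mkseq // => i iv.
by rewrite nth_mkseq // /splice iv.
Qed.

Lemma spliceD v z i : splice v z (size v + i) = z i.
Proof. by rewrite /splice ltnNge leq_addr /= addKn. Qed.

Lemma mkseqP y z n : mkseq y n = mkseq z n <-> (forall i, i < n -> y i = z i).
Proof.
split=> [yz i ltin|yz].
  by rewrite -(nth_mkseq (y 0) y ltin) yz nth_mkseq.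
by rewrite /mkseq; apply/eq_in_map => i; rewrite mem_iota => /yz.
Qed.

Lemma mkseq_le y z m n : m <= n -> mkseq y n = mkseq z n -> mkseq y m = mkseq z m.
Proof. by move=> mn /mkseqP yz; apply/mkseqP => i im; apply/yz/(leq_trans im). Qed.

Lemma eq_mkseqT y z : (forall n, mkseq y n = mkseq z n) -> y = z.
Proof. by move=> yz; apply/funext => n; have /mkseqP/(_ n (ltnSn n)) := yz n.+1. Qed.

End Sequences.

(** * Words over the alphabet and the points that sequences spell *)

(* [inl] letters are bits; a letter [inr (u, _, _)] restarts the word of bits
   at [u]; its other components carry no bits, they only provide infinitely
   many letters of every kind. *)
Notation letter := (bool + (seq bool * (bool + nat) * nat))%type.

Definition bits_step (u : seq bool) (a : letter) : seq bool :=
  match a with inl b => rcons u b | inr (u', _, _) => u' end.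

Definition bits (v : seq letter) : seq bool := foldl bits_step [::] v.

Lemma bits_rcons v a : bits (rcons v a) = bits_step (bits v) a.
Proof. by rewrite /bits foldl_rcons. Qed.

(** The offset [m] counts the bits read so far; it may differ from [N], because a marker replaces
    the word of bits by one of any length. *)
Definition spells_from N (y : nat -> letter) (x : nat -> bool) :=
  let m := size (bits (mkseq y N)) in
  mkseq x m = bits (mkseq y N) /\ forall i, y (N + i) = inl (x (m + i)).

Definition spells y x := exists N, spells_from N y x.

Lemma spells_fromS N y x : spells_from N y x -> spells_from N.+1 y x.
Proof.
move=> [xN yN]; have yNN := yN 0; rewrite !addn0 in yNN.
rewrite /spells_from /= mkseqS bits_rcons yNN /= size_rcons; split.
  by rewrite mkseqS xN.
by move=> i; rewrite !addSnnS yN.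
Qed.

Lemma spells_from_le N M y x : N <= M -> spells_from N y x -> spells_from M y x.
Proof.
move=> /subnK <-; elim: (M - N) => // k IHk /IHk.
exact: spells_fromS.
Qed.

Lemma spells_from_size N y x i : spells_from N y x ->
  size (bits (mkseq y (N + i))) = size (bits (mkseq y N)) + i.
Proof.
move=> sN; elim: i => [|i IHi]; first by rewrite !addn0.
rewrite addnS mkseqS bits_rcons; case: sN => _ ->.
by rewrite /= size_rcons IHi addnS.
Qed.

Lemma spells_from_inj N y x x' :
  spells_from N y x -> spells_from N y x' -> x = x'.
Proof.
move=> [xN yN] [x'N y'N]; apply/funext => n.
set m := size _ in xN yN x'N y'N.
have [nm|mn] := ltnP n m.
  by rewrite -(nth_mkseq false x nm) xN -x'N nth_mkseq.
by move: (yN (n - m)); rewrite y'N subnKC // => -[].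
Qed.

Lemma spells_inj y x x' : spells y x -> spells y x' -> x = x'.
Proof.
move=> [N sN] [M sM]; apply: (@spells_from_inj (N + M) y).
  by apply: spells_from_le sN; rewrite leq_addr.
by apply: spells_from_le sM; rewrite leq_addl.
Qed.

Definition bits_tail (w : seq letter) (x : nat -> bool) : nat -> letter :=
  splice w (fun i => inl (x (size (bits w) + i))).

Lemma spells_bits_tail w x : mkseq x (size (bits w)) = bits w ->
  spells_from (size w) (bits_tail w x) x.
Proof.
move=> xw; rewrite /spells_from /= mkseq_splice; split=> // i.
by rewrite /bits_tail spliceD.
Qed.

(** A spelled sequence is thus coded by a finite word and a point. This identifies a followed
    sequence with the input, and later bounds the size of the space. *)
Lemma eq_bits_tail N y x : spells_from N y x -> y = bits_tail (mkseq y N) x.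
Proof.
move=> [_ yN]; apply/funext => n; rewrite /bits_tail /splice size_mkseq.
case: ltnP => [nN|Nn]; first by rewrite nth_mkseq.
by rewrite -yN subnKC.
Qed.

Definition spelled (X : set (nat -> bool)) : set (nat -> letter) :=
  [set y | exists2 x, X x & spells y x].


(** Bijections chosen on the fibres are glued; applied to labels, this yields the bijections of the
    alphabet. *)
Lemma bij_of_fibres (A B T : Type) (f : A -> T) (g : B -> T) :
  (forall t, f @^-1` [set t] #= g @^-1` [set t]) ->
  exists b : A -> B, exists c : B -> A,
    [/\ cancel b c, cancel c b & forall a, g (b a) = f a].
Proof.
move=> fg.
have H t : exists h : f @^-1` [set t] -> g @^-1` [set t], bijective h.
  exact/card_bijP.
pose h t := projT1 (cid (H t)).
have hbij t : bijective (h t) := projT2 (cid (H t)).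
pose b a := val (h (f a) (SigSub (mem_set (erefl (f a))))).
have gb a : g (b a) = f a by exact: set_mem (valP (h _ _)).
(* Any [t] equal to [f a] may serve to compute [b a], which avoids transport between fibres. *)
have bE t a (ta : a \in f @^-1` [set t]) : b a = val (h t (SigSub ta)).
  have E := set_mem ta; rewrite /= in E; subst t.
  by rewrite /b; congr (val (h _ _)); exact: val_inj.
have binj : injective b.
  move=> a a' bb; have faa' : a' \in f @^-1` [set f a].
    by rewrite inE /= -!gb bb.
  move: bb; rewrite (bE _ _ faa') /b => /val_inj /(bij_inj (hbij _)).
  by move/(congr1 val).
have bsurj x : exists a, b a = x.
  have [h' _ hh'] := hbij (g x).
  have xg : x \in g @^-1` [set g x] by rewrite inE.
  exists (val (h' (SigSub xg))); rewrite (bE (g x) _ (valP _)).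
  rewrite (_ : SigSub _ = h' (SigSub xg)); last exact: val_inj.
  by rewrite hh'.
have [c cP] := boolp.choice bsurj.
by exists b, c; split=> // a; exact/binj/cP.
Qed.

(** * The automaton, the kinds of its states and the labels of letters *)

Section Automaton.
Context (F : nat -> set (nat -> bool)) (single : nat -> option (nat -> bool)).

(** This is membership of [u] in the tree of prefixes of [F k]. *)
Definition hits (k : nat) (u : seq bool) : bool :=
  `[< exists2 x, F k x & mkseq x (size u) = u >].

Definition least_hitting (u : seq bool) : option nat :=
  if pselect (exists k, hits k u) is left h then Some (ex_minn h) else None.

(* [(v, inl k)]: after reading [v], letters are copied as long as the bits stay
   in the tree of [F k]; [(v, inr d)]: the point [d] is being followed. *)
Definition state := (seq letter * (nat + (nat -> letter)))%type.

(** A piece flagged by [single] is never copied: its point must be reached by following a sequence,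
    whose membership in [D] the kind records. *)
Definition stays (q : state) (a : letter) : bool :=
  match q.2, a with
  | inl k, inl b => ~~ isSome (single k) && hits k (rcons (bits q.1) b)
  | inl _, inr _ => false
  | inr d, _ => a == d (size q.1)
  end.

(** The value [inl 0] is a default for bits that lie in the tree of no piece. Following
    [bits_tail w x] keeps the word already read. *)
Definition target (pick : bool -> seq letter -> nat -> letter)
    (v : seq letter) (a : letter) : nat + (nat -> letter) :=
  let w := rcons v a in
  match a with
  | inr (_, inl c, _) => inr (pick c w)
  | inr (_, inr k, _) => inl k
  | inl _ =>
    if least_hitting (bits w) is Some k then
      if single k is Some x then inr (bits_tail w x) else inl k
    else inl 0
  end.

Definition step pick (q : state) (a : letter) : state :=
  (rcons q.1 a, if stays q a then q.2 else target pick q.1 a).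

(** A followed point is forgotten except for its membership in [D], so that any point of [D] can be
    matched with any point of [E]. *)
Definition kind (D : set (nat -> letter)) (q : state) : (seq bool * nat) + bool :=
  match q.2 with inl k => inl (bits q.1, k) | inr d => inr `[< D d >] end.

(** Preserving labels forces a bit that stays in a piece to be copied, and the next letter of one
    followed point to go to that of the other; the remaining letters only have to lead to equal
    kinds. *)
Definition label D pick (q : state) (a : letter) :
    option letter + ((seq bool * nat) + bool) :=
  if stays q a then inl (if q.2 is inl _ then Some a else None)
  else inr (kind D (step pick q a)).

Fixpoint run pick (y : nat -> letter) n : state :=
  if n is m.+1 then step pick (run pick y m) (y m) else ([::], inl 0).

Lemma run_word pick y n : (run pick y n).1 = mkseq y n.
Proof. by elim: n => // n IHn; rewrite /= IHn mkseqS. Qed.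

Lemma kind_step D E pick pick' q q' a a' : kind D q = kind E q' ->
  label D pick q a = label E pick' q' a' ->
  kind D (step pick q a) = kind E (step pick' q' a').
Proof.
rewrite /label; have [sa|_] := boolP (stays q a);
  have [sa'|_] := boolP (stays q' a') => //.
  move: sa sa'; rewrite /kind /step => sa sa'; rewrite sa sa' /=.
  case: q sa => v [k|d] sa; case: q' sa' => v' [k'|d'] sa' //=.
  by rewrite !bits_rcons => -[-> ->] [->].
by move=> _ [].
Qed.

(** Markers reach every kind: [(u, inr k, _)] selects the bits [u] and the piece [k],
    [(_, inl c, _)] a point inside or outside [D]. The last component makes them infinitely many. *)
Lemma infinite_fresh D pick q t : (forall (c : bool) w, D (pick c w) <-> c) ->
  infinite_set (label D pick q @^-1` [set inr t]).
Proof.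
move=> pickD.
(* Counters from [c0] on differ from the one, if any, in the next letter of the followed point. *)
pose c0 := if q.2 is inr d then
  if d (size q.1) is inr (_, _, j) then j.+1 else 0 else 0.
have fresh u z i : stays q (inr (u, z, i + c0)) = false.
  rewrite /stays /c0; case: q.2 => // d.
  case: (d (size q.1)) => // -[[u' z'] j].
  by apply/eqP => -[_ _ /eqP]; rewrite gtn_eqF // addnS ltnS leq_addl.
pose z := match t with inl (u, k) => (u, inr k) | inr c => ([::], inl c) end.
apply/infiniteP; apply: (@set_inj_card_le _ _ _ _ (fun i => inr (z, i + c0)));
  last by move=> i j _ _ [] /addIn.
move=> i _; rewrite /= /label.
have := fresh z.1 z.2 i; rewrite -surjective_pairing => fz.
rewrite fz; congr inr; rewrite /kind /step fz /z /=.
case: t {z fz} => [[u k]|c] /=; first by rewrite bits_rcons.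
by congr inr; apply/idP/idP => [/asboolP/pickD|/pickD/asboolP].
Qed.

(** The fibre of a leaving label is countably infinite on both sides. The staying letters depend
    only on the bits and the piece, or reduce to one letter when a point is followed. *)
Lemma label_fibres D E pick pick' q q' : 
  (forall (c : bool) w, D (pick c w) <-> c) ->
  (forall (c : bool) w, E (pick' c w) <-> c) ->
  kind D q = kind E q' -> forall t,
  label D pick q @^-1` [set t] #= label E pick' q' @^-1` [set t].
Proof.
move=> pD pE qq' [|t]; last first.
  apply: (@card_eq_trans _ _ _ _ [set: nat]); last apply: card_esym.
    by apply: eq_card_nat => //; exact: infinite_fresh.
  by apply: eq_card_nat => //; exact: infinite_fresh.
case: q qq' => v [k|d]; case: q' => v' [k'|d'] //=.
  rewrite /kind /= => -[vv' <-] o.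
  rewrite (_ : _ @^-1` _ = label E pick' (v', inl k) @^-1` [set inl o]) //.
  by apply/seteqP; split=> a /=; rewrite /label /stays /= vv'; case: ifP.
move=> _ [a|].
  rewrite (_ : _ @^-1` _ = set0); last first.
    by rewrite -subset0 => x /=; rewrite /label; case: ifP.
  rewrite (_ : _ @^-1` _ = set0) ?card_eq00 //.
  by rewrite -subset0 => x /=; rewrite /label; case: ifP.
rewrite (_ : _ @^-1` _ = [set d (size v)]); last first.
  by apply/seteqP; split=> a /=; rewrite /label /stays /=; case: eqP.
rewrite (_ : _ @^-1` _ = [set d' (size v')]) ?eq_card1 //.
by apply/seteqP; split=> a /=; rewrite /label /stays /=; case: eqP.
Qed.

Lemma hits_mkseq k x m n : m <= n -> hits k (mkseq x n) -> hits k (mkseq x m).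
Proof.
move=> mn /asboolP[z Fz]; rewrite !size_mkseq => zx.
by apply/asboolP; exists z; rewrite // size_mkseq; exact: mkseq_le zx.
Qed.

Lemma least_hittingP u k : hits k u -> (forall j, j < k -> ~~ hits j u) ->
  least_hitting u = Some k.
Proof.
move=> mk mj; rewrite /least_hitting; case: pselect => [h|]; last by case; exists k.
case: ex_minnP => m mm minm; congr Some; apply/eqP.
by rewrite eqn_leq minm //= leqNgt; apply/negP => /mj; rewrite mm.
Qed.

(** * Eventual constancy of the automaton along spelled sequences *)

Section Settling.
Context (X : set (nat -> bool)) (D : set (nat -> letter))
  (pick : bool -> seq letter -> nat -> letter).
Hypothesis F_closed :
  forall k x, (forall n, hits k (mkseq x n)) -> F k x.
Hypothesis F_cover : forall x, X x -> exists k, F k x.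
Hypothesis F_single :
  forall k x, single k = Some x -> F k = [set x] /\ X x.
Hypothesis pickP : forall c w, mkseq (pick c w) (size w) = w /\
  spelled X (pick c w).

(** The point extends the word read when it is selected, and each later staying letter is its next
    letter. Hence a point followed forever is the input itself. *)
Lemma run_point y n d : (run pick y n).2 = inr d ->
  mkseq d n = mkseq y n /\ spelled X d.
Proof.
elim: n => //= n IHn; have [sy|_] := ifPn.
  move=> rd; move: sy; rewrite /stays rd run_word size_mkseq => /eqP yd.
  by have [dy Xd] := IHn rd; rewrite !mkseqS yd dy.
rewrite run_word /target -mkseqS.
set w := mkseq y n.+1.
have sw : size w = n.+1 by rewrite size_mkseq.
case: (y n) => [b|[[u [c|k]] i]] //.
  rewrite /least_hitting; case: pselect => // h; case: ex_minnP => k.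
  case Ek : (single k) => [x|//] /asboolP[z Fz zw] _ [<-].
  have [Fk Xx] := F_single Ek; move: Fz; rewrite Fk => /= zx; subst z.
  split; first by rewrite /bits_tail -sw mkseq_splice.
  by exists x => //; exists (size w); exact: spells_bits_tail.
by move=> [<-]; rewrite -sw; exact: pickP.
Qed.

(** Past some stage the least piece hit by the bits is the least [F k] containing [x]. Either no
    letter leaves after that stage, or one that does selects this piece, which no later letter
    leaves. *)
Lemma run_settles y : spelled X y ->
  exists M, forall n, M <= n -> stays (run pick y n) (y n).
Proof.
move=> [x Xx [N sN]].
pose m := size (bits (mkseq y N)).
have bitsE i : bits (mkseq y (N + i)) = mkseq x (m + i).
  have [xi _] := spells_from_le (leq_addr i N) sN.
  by rewrite -xi (spells_from_size _ sN).
have [k Fkx kmin] : exists2 k, F k x & forall j, j < k -> ~ F j x.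
  have [k0 Fk0] := F_cover Xx.
  have h : exists k, `[< F k x >] by exists k0; apply/asboolP.
  exists (ex_minn h); case: ex_minnP => k /asboolP // Fk kmin j jk Fj.
  by have := kmin j (asboolT Fj); rewrite leqNgt jk.
(* Each of the finitely many closed sets [F j] with [j < k] misses [x], hence its tree loses the
   prefixes of [x] at some length. *)
have [I Imin] : exists I,
    forall j, j < k -> forall i, I <= i -> ~~ hits j (mkseq x i).
  elim: (k) kmin => [|k' IHk] kmin; first by exists 0.
  have [|I IH] := IHk; first by move=> j jk; apply: kmin; exact: ltnW.
  have [n nn] : exists n, ~~ hits k' (mkseq x n).
    apply: contrapT => /forallNP nmeets; apply: (kmin k') => //.
    by apply: F_closed => n; apply/negPn/negP; exact: nmeets.
  exists (maxn I n) => j; rewrite ltnS leq_eqVlt => /predU1P[->|jk] i.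
    rewrite geq_max => /andP[_ ni].
    by apply: contra nn; exact: hits_mkseq.
  by rewrite geq_max => /andP[Ii _]; exact: IH.
have leastE i : I <= i -> least_hitting (mkseq x i) = Some k.
  move=> Ii; apply: least_hittingP => [|j jk]; last exact: Imin.
  by apply/asboolP; exists x; rewrite ?size_mkseq.
have [stay|/existsNP[n]] := pselect
    (forall n, N + I <= n -> stays (run pick y n) (y n)).
  by exists (N + I).
move=> /not_implyP[] NIn /negP nstay.
have Nn : N <= n by apply: leq_trans NIn; exact: leq_addr.
have y_inl i : y (N + i) = inl (x (m + i)) by case: sN.
(* This is the mode selected at [n]; in the singleton case the followed sequence is [y] itself, by
   [eq_bits_tail]. *)
pose P := if single k is Some x then inr (bits_tail (mkseq y n.+1) x) else inl k.
have run0 : (run pick y n.+1).2 = P.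
  have leastn : least_hitting (bits (mkseq y n.+1)) = Some k.
    have In : I <= n - N by rewrite leq_subRL.
    rewrite -(subnKC (leqW Nn)) bitsE leastE // (leq_trans In) //.
    by rewrite (@leq_trans (n.+1 - N)) ?leq_addl // leq_sub2r.
  have yn : y n = inl (x (m + (n - N))) by rewrite -y_inl subnKC.
  by rewrite /= (negbTE nstay) run_word /target -mkseqS yn leastn.
have run_stays j : (run pick y j).2 = P -> n < j -> stays (run pick y j) (y j).
  move=> jP nj; have Nj : N <= j by rewrite (leq_trans Nn) // ltnW.
  rewrite /stays jP /P run_word; case Ek : (single k) => [x'|] /=.
    have [Fk _] := F_single Ek; move: Fkx; rewrite Fk => /= xx'; rewrite -xx'.
    rewrite size_mkseq -eq_bits_tail //.
    by apply: spells_from_le sN; exact: (leq_trans Nn).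
  rewrite -(subnKC Nj) y_inl bitsE -mkseqS Ek /=.
  by apply/asboolP; exists x; rewrite // size_mkseq.
have runP i : (run pick y (n.+1 + i)).2 = P.
  elim: i => [|i IHi]; first by rewrite addn0.
  have nj : n < n.+1 + i by rewrite leq_addr.
  by rewrite addnS; move: (n.+1 + i) IHi nj => j jP nj /=; rewrite run_stays.
exists n.+1 => j nj; apply: run_stays => //.
by rewrite -(subnKC nj).
Qed.

Lemma run_settled y : spelled X y -> exists M P, forall n, M <= n ->
  (run pick y n).2 = P /\ stays (run pick y n) (y n).
Proof.
move=> /run_settles[M stay]; exists M, (run pick y M).2 => n Mn.
split; last exact: stay.
rewrite -(subnKC Mn); elim: (n - M) => [|i IHi]; first by rewrite addn0.
by rewrite addnS /= stay // leq_addr.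
Qed.

End Settling.

Definition matched D pick E pick' y z := forall n,
  kind D (run pick y n) = kind E (run pick' z n) /\
  label D pick (run pick y n) (y n) = label E pick' (run pick' z n) (z n).

Lemma matched_sym D pick E pick' y z :
  matched D pick E pick' y z -> matched E pick' D pick z y.
Proof. by move=> yz n; have [-> ->] := yz n. Qed.

End Automaton.

(** * The isometry obtained from two matched automata *)

Section Isometry.
Context (F : nat -> set (nat -> bool)) (single : nat -> option (nat -> bool)).
Context (X : set (nat -> bool)).
Hypothesis F_closed :
  forall k x, (forall n, hits F k (mkseq x n)) -> F k x.
Hypothesis F_cover : forall x, X x -> exists k, F k x.
Hypothesis F_single :
  forall k x, single k = Some x -> F k = [set x] /\ X x.

Local Notation run := (run F single).
Local Notation step := (step F single).
Local Notation stays := (stays F single).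
Local Notation label := (label F single).
Local Notation matched := (matched F single).

Definition picks_points (D : set (nat -> letter))
    (pick : bool -> seq letter -> nat -> letter) :=
  forall c w, [/\ mkseq (pick c w) (size w) = w, spelled X (pick c w) &
    D (pick c w) <-> c].

Definition misses (D : set (nat -> letter)) :=
  forall k x d, single k = None -> F k x -> D d -> ~ spells d x.

Lemma label_stays D E pick pick' q q' a a' :
  label D pick q a = label E pick' q' a' -> stays q a = stays q' a'.
Proof. by rewrite /label; case: ifP; case: ifP. Qed.

(** The automaton settles along [y], and equal labels settle the other one along [z]. In a piece,
    [z] copies [y] and spells the same [x], and [misses] excludes both memberships; otherwise [y]
    and [z] are the followed points, whose memberships agree by kind. *)
Lemma matched_spelled D E pick pick' y z :
  picks_points D pick -> picks_points E pick' -> misses D -> misses E ->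
  matched D pick E pick' y z -> spelled X y ->
  spelled X z /\ (D y <-> E z).
Proof.
move=> pickD pickE missD missE yz Xy.
have pickDP c w : mkseq (pick c w) (size w) = w /\ spelled X (pick c w).
  by have [] := pickD c w.
have pickEP c w : mkseq (pick' c w) (size w) = w /\ spelled X (pick' c w).
  by have [] := pickE c w.
have [M [P settled]] := run_settled pick F_closed F_cover F_single Xy.
have zstay n : M <= n -> stays (run pick' z n) (z n).
  move=> /settled[_ sy]; have [_ t] := yz n.
  by rewrite -(label_stays t).
have zP n : M <= n -> (run pick' z n).2 = (run pick' z M).2.
  move=> Mn; rewrite -(subnKC Mn); elim: (n - M) => [|i IHi]; first by rewrite addn0.
  by rewrite addnS /= zstay // leq_addr.
case EP : P => [k|d].
  have same n : M <= n -> bits (mkseq z n) = bits (mkseq y n) /\ z n = y n.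
    move=> Mn; have [yP sy] := settled _ Mn; have [kk tt] := yz n.
    move: kk tt; rewrite /kind /label sy zstay // yP EP !run_word.
    by case: (run pick' z n).2 => // k' -[->] _ [->].
  have [x Xx [N sN]] := Xy.
  have sy := spells_from_le (leq_maxl N M) sN.
  set K := maxn N M in sy *.
  have MK : M <= K by rewrite leq_maxr.
  have sz : spells_from K z x.
    have [bz _] := same _ MK.
    case: sy => sy1 sy2; split; rewrite bz // => i.
    by have [_ ->] := same (K + i) (leq_trans MK (leq_addr _ _)).
  (* A letter staying in a piece certifies that [single] does not flag it, and that the tree
     contains the bits read; since [F k] is closed, it contains [x]. *)
  have [nk Fkx] : single k = None /\ F k x.
    have sk n : M <= n -> exists b, y n = inl b /\ single k = None /\
        hits F k (rcons (bits (mkseq y n)) b).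
      move=> /settled[yP]; rewrite /stays yP EP run_word.
      by case: (y n) => // b /andP[]; case: single => // _ ?; exists b.
    split; first by have [b [_ []]] := sk _ MK.
    apply: F_closed => n.
    have [b [yb [_]]] := sk (K + n) (leq_trans MK (leq_addr _ _)).
    have [yK yi] := sy.
    have [xn _] := spells_from_le (leq_addr n K) sy.
    have := spells_from_size n sy.
    move: yb; rewrite yi => -[<-]; set m := size (bits (mkseq y K)) => sm.
    rewrite -xn sm -mkseqS; apply: hits_mkseq.
    by rewrite ltnW // ltnS leq_addl.
  split; first by exists x => //; exists K.
  split=> [Dy|Ez]; exfalso.
    by apply: (missD k x y nk Fkx Dy); exists N.
  by apply: (missE k x z nk Fkx Ez); exists K.
have yd : y = d.
  apply: eq_mkseqT => n; apply: (mkseq_le (leq_maxl n M)).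
  have [rd _] := settled _ (leq_maxr n M).
  by have [] := run_point F_single pickDP (etrans rd EP).
have [kk _] := yz M.
have [yP _] := settled _ (leqnn M).
move: kk; rewrite /kind yP EP.
case Ed' : (run pick' z M).2 => [//|d'] -[DE].
have zd : z = d'.
  apply: eq_mkseqT => n; apply: (mkseq_le (leq_maxl n M)).
  have rd := zP _ (leq_maxr n M).
  by have [] := run_point F_single pickEP (etrans rd Ed').
split; first by rewrite zd; have [] := run_point F_single pickEP Ed'.
by rewrite yd zd; split=> /asboolP; [rewrite DE|rewrite -DE] => /asboolP.
Qed.

(** Each output letter is the image of the input letter under a label-preserving bijection that
    depends only on earlier letters; this makes both maps preserve common prefixes. *)
Lemma ex_isometry D E pick pick' :
  picks_points D pick -> picks_points E pick' -> misses D -> misses E ->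
  exists f g : (nat -> letter) -> nat -> letter,
  [/\ cancel f g, cancel g f,
    forall y y' n, mkseq y n = mkseq y' n -> mkseq (f y) n = mkseq (f y') n,
    forall y y' n, mkseq y n = mkseq y' n -> mkseq (g y) n = mkseq (g y') n &
    (forall y, spelled X y -> spelled X (f y) /\ (D y <-> E (f y))) /\
    (forall y, spelled X y -> spelled X (g y))].
Proof.
move=> pickD pickE missD missE.
have pD c w : D (pick c w) <-> c by have [] := pickD c w.
have pE c w : E (pick' c w) <-> c by have [] := pickE c w.
have /boolp.choice[bc bcP] (qq : state * state) :
    exists bc : (letter -> letter) * (letter -> letter),
    kind D qq.1 = kind E qq.2 -> [/\ cancel bc.1 bc.2, cancel bc.2 bc.1 &
      forall a, label E pick' qq.2 (bc.1 a) = label D pick qq.1 a].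
  have [qk|] := pselect (kind D qq.1 = kind E qq.2); last by exists (id, id).
  have [b [c bcP]] := bij_of_fibres (label_fibres F single pD pE qk).
  by exists (b, c).
pose q0 : state * state := (([::], inl 0), ([::], inl 0)).
pose fix fw (y : nat -> letter) n : state * state :=
  if n is m.+1 then
    let q := fw y m in (step pick q.1 (y m), step pick' q.2 ((bc q).1 (y m)))
  else q0.
(* [bw] recovers the same pairs of states from the output, through the inverse bijections, so that
   [g] inverts [f]. *)
pose fix bw (z : nat -> letter) n : state * state :=
  if n is m.+1 then
    let q := bw z m in (step pick q.1 ((bc q).2 (z m)), step pick' q.2 (z m))
  else q0.
pose f y n := (bc (fw y n)).1 (y n).
pose g z n := (bc (bw z n)).2 (z n).
have fwk y n : kind D (fw y n).1 = kind E (fw y n).2.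
  elim: n => //= n IHn; apply: kind_step => //; symmetry.
  by have [_ _ ->] := bcP _ IHn.
have bwk z n : kind D (bw z n).1 = kind E (bw z n).2.
  elim: n => //= n IHn; apply: kind_step => //; symmetry.
  by have [_ c2 <-] := bcP _ IHn; rewrite c2.
have bwf y n : bw (f y) n = fw y n.
  elim: n => //= n ->; congr pair; rewrite /f.
  by have [-> _ _] := bcP _ (fwk y n).
have fwg z n : fw (g z) n = bw z n.
  elim: n => //= n ->; congr pair; rewrite /g.
  by have [_ -> _] := bcP _ (bwk z n).
have fwrun y n : fw y n = (run pick y n, run pick' (f y) n).
  by elim: n => //= n IHn; rewrite [in LHS]IHn /= /f IHn.
have fm y : matched D pick E pick' y (f y).
  move=> n; have := fwk y n; rewrite fwrun /= => kn; split=> //.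
  by rewrite /f fwrun; have [_ _ ->] := bcP (_, _) kn.
have fgK : cancel f g.
  move=> y; apply/funext => n; rewrite /g bwf /f.
  by have [-> _ _] := bcP _ (fwk y n).
have gfK : cancel g f.
  move=> z; apply/funext => n; rewrite /f fwg /g.
  by have [_ -> _] := bcP _ (bwk z n).
exists f, g; split=> //.
- move=> y y' n /mkseqP yy'; apply/mkseqP => i ltin; rewrite /f yy' //.
  suff -> : fw y i = fw y' i by [].
  elim: i ltin => //= i IHi ltin.
  by rewrite IHi ?yy' // ltnW.
- move=> y y' n /mkseqP yy'; apply/mkseqP => i ltin; rewrite /g yy' //.
  suff -> : bw y i = bw y' i by [].
  elim: i ltin => //= i IHi ltin.
  by rewrite IHi ?yy' // ltnW.
- split=> y Xy; first exact: (matched_spelled pickD pickE missD missE (fm y)).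
  (* Matching is symmetric, so [g y] is spelled because [f (g y) = y] is. *)
  have [] // := matched_spelled pickE pickD missE missD (matched_sym (fm (g y))).
  by rewrite gfK.
Qed.

End Isometry.

(** * Cylinders and the ultrametric space of spelled sequences *)

Lemma cantor_open_cylinder (O : set cantor_space) (x : cantor_space) :
  open O -> O x -> exists n, forall z : cantor_space, mkseq z n = mkseq x n -> O z.
Proof.
move=> Oo Ox; apply: contrapT => /forallNP noO.
(* Points outside [O] that share ever longer prefixes with [x] converge to [x] pointwise. *)
have /boolp.choice[z zP] n : exists z : cantor_space, mkseq z n = mkseq x n /\ ~ O z.
  by have /existsNP[z /not_implyP] := noO n; exists z.
have zx : z @ \oo --> x.
  apply/(@pointwise_cvgP nat bool) => i.
  rewrite -[X in X --> _]/(z n i @[n --> \oo]); apply: cvg_near_cst.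
  near=> n; have /mkseqP zx := (zP n).1; apply: zx.
  by near: n; exists i.+1.
have [n _ /(_ n (leqnn n))] := zx _ (open_nbhs_nbhs (conj Oo Ox)).
exact: (zP n).2.
Unshelve. all: by end_near. Qed.

(* [R] is a phantom parameter: it lets the topology be inferred from the type. *)
Definition spelled_space (R : realType) (X : set (nat -> bool)) : Type :=
  set_type (spelled X).

Section Space.
Context (R : realType) (X : set (nat -> bool)).
Local Notation spelled_space := (spelled_space R X).

HB.instance Definition _ := Choice.on spelled_space.

Definition dist (y z : nat -> letter) : R :=
  if pselect (exists n, y n != z n) is left h then ((ex_minn h).+1%:R^-1)%R else 0%R.

Lemma dist_ge (y z : nat -> letter) i : y i != z i -> (i.+1%:R^-1 <= dist y z)%R.
Proof.
move=> yz; rewrite /dist; case: pselect => [h|]; last by case; exists i.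
by case: ex_minnP => m _ /(_ _ yz) mi; rewrite lef_pV2 ?posrE ?ltr0n // ler_nat.
Qed.

Lemma dist_ltP (y z : nat -> letter) n :
  (dist y z < n.+1%:R^-1)%R <-> mkseq y n.+1 = mkseq z n.+1.
Proof.
split=> [yzn|/mkseqP yz].
  apply/mkseqP => i ltin; apply/eqP/negPn/negP => /dist_ge.
  apply/negP; rewrite -ltNge (lt_le_trans yzn) //.
  by rewrite lef_pV2 ?posrE ?ltr0n // ler_nat.
rewrite /dist; case: pselect => [h|_]; last by rewrite invr_gt0 ltr0n.
case: ex_minnP => m /negP yzm _; rewrite ltf_pV2 ?posrE ?ltr0n // ltr_nat ltnS.
by rewrite ltnNge; apply/negP => mn; apply: yzm; rewrite yz.
Qed.

Let mdist (y z : spelled_space) : R := dist (val y) (val z).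

Let mdistxx y : mdist y y = 0%R.
Proof.
rewrite /mdist /dist; case: pselect => // h.
by exfalso; case: h => n; rewrite eqxx.
Qed.

Let mdist_positivity y z : mdist y z = 0%R -> y = z.
Proof.
move=> yz0; apply/val_inj/funext => i; apply/eqP/negPn/negP => /dist_ge.
by rewrite -/(mdist _ _) yz0 leNgt invr_gt0 ltr0n.
Qed.

Let mdist_sym y z : mdist y z = mdist z y.
Proof.
apply/eqP; wlog suff: y z / (mdist y z <= mdist z y)%R.
  by move=> H; rewrite eq_le !H.
rewrite {1}/mdist {1}/dist; case: pselect => [h|_].
  by case: ex_minnP => m yzm _; apply: dist_ge; rewrite eq_sym.
by rewrite /mdist /dist; case: pselect => // h; rewrite invr_ge0.
Qed.

Let mdist_triangle x y z : (mdist y z <= mdist y x + mdist x z)%R.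
Proof.
have mdist_ge0 a b : (0 <= mdist a b)%R.
  by rewrite /mdist /dist; case: pselect => // h; rewrite invr_ge0.
rewrite {1}/mdist {1}/dist; case: pselect => [h|_]; last exact: addr_ge0.
case: ex_minnP => m yzm _.
(* At the first difference of [y] and [z], the point [x] differs from one of them, so one summand
   alone bounds the distance. *)
have [yx|yx] := eqVneq (val y m) (val x m).
  rewrite ler_wpDl // dist_ge // -yx //.
by rewrite ler_wpDr // dist_ge.
Qed.

HB.instance Definition _ := isMetric.Build R spelled_space
  mdistxx mdist_positivity mdist_sym mdist_triangle.

Lemma nbhs_cylinder (y : spelled_space) (A : set spelled_space) :
  nbhs y A <-> exists n, forall z : spelled_space,
    mkseq (val z) n = mkseq (val y) n -> A z.
Proof.
split.
  move=> /nbhs_ballP[e /= e0 yeA].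
  have [n ne] := ex_invS_lt e0.
  exists n.+1 => z zy; apply: yeA; rewrite ballEmdist /=.
  by apply: lt_trans ne; apply/dist_ltP.
move=> [n yA]; apply/nbhs_ballP; exists (n.+1%:R^-1)%R => /=.
  by rewrite invr_gt0 ltr0n.
move=> z; rewrite ballEmdist /= => /dist_ltP yz.
by apply: yA; symmetry; apply: mkseq_le yz.
Qed.

Lemma continuous_prefix (f : spelled_space -> spelled_space) :
  (forall y z n, mkseq (val y) n = mkseq (val z) n ->
     mkseq (val (f y)) n = mkseq (val (f z)) n) -> continuous f.
Proof.
move=> fP y A /nbhs_cylinder[n fyA]; apply/nbhs_cylinder.
by exists n => z zy; apply/fyA/fP.
Qed.

(** The marker empties the word of bits, so every point of [X] can be spelled after any [w]: each
    cylinder contains a copy of [X]. *)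
Definition restart (w : seq letter) (x : nat -> bool) : nat -> letter :=
  bits_tail (rcons w (inr ([::], inl true, 0))) x.

Lemma restart_spelled w x : X x -> spelled X (restart w x).
Proof.
move=> Xx; exists x => //; exists (size (rcons w (inr ([::], inl true, 0)))).
by apply: spells_bits_tail; rewrite bits_rcons.
Qed.

Lemma mkseq_restart w x : mkseq (restart w x) (size w).+1 =
  rcons w (inr ([::], inl true, 0)).
Proof.
rewrite -[in LHS](size_rcons w (inr ([::], inl true, 0))).
exact: mkseq_splice.
Qed.

Lemma restart_prefix w x : mkseq (restart w x) (size w) = w.
Proof.
by have := mkseq_restart w x; rewrite mkseqS => /rcons_inj[].
Qed.

Lemma restart_inj w : injective (restart w).
Proof.
move=> x x' /(congr1 (fun y i => y ((size w).+1 + i))) e.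
apply/funext => i; have := congr1 (@^~ i) e.
rewrite /restart /bits_tail -!(size_rcons w (inr ([::], inl true, 0))).
by rewrite !spliceD bits_rcons => -[].
Qed.

Definition restart_point w x (Xx : X x) : spelled_space :=
  SigSub (mem_set (restart_spelled w Xx)).

Lemma open_prefix w : open [set y : spelled_space | mkseq (val y) (size w) = w].
Proof.
rewrite openE => y /= yw; apply/nbhs_cylinder; exists (size w) => z e /=.
by rewrite e.
Qed.

Hypothesis X0 : X !=set0.

Lemma dense_prefix (D : set spelled_space) : dense D <->
  forall w, exists2 d, D d & mkseq (val d) (size w) = w.
Proof.
split=> [denseD w|hitD O [y Oy] openO].
  have [|d [dw Dd]] := denseD _ _ (@open_prefix w); last by exists d.
  by have [x Xx] := X0; exists (restart_point w Xx); exact: restart_prefix.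
have [n yO] := (nbhs_cylinder y O).1 (open_nbhs_nbhs (conj openO Oy)).
have [d Dd dy] := hitD (mkseq (val y) n).
by exists d; split=> //; apply: yO; rewrite size_mkseq in dy.
Qed.

Lemma spelled_space_separable : separable spelled_space.
Proof.
have [x Xx] := X0; exists [set restart_point w Xx | w in [set: seq letter]].
  exact: countable_image.
by apply/dense_prefix => w; exists (restart_point w Xx) => //; exact: restart_prefix.
Qed.

(** The pieces collect the sequences without markers from [N] on; restarting at or after [N] leaves
    the closure of such a piece. *)
Lemma spelled_space_meager : meager_in_itself spelled_space.
Proof.
have [x Xx] := X0.
exists (fun N => [set y | forall n, N <= n -> exists b, val y n = inl b]).
  move=> N; rewrite /nowhere_dense -subset0 => y /nbhs_cylinder[n cylF].
  (* Length [n] keeps the restart in the cylinder; length [N] puts its marker at a forbidden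
     position. *)
  pose w := mkseq (val y) (maxn n N).
  have sw : size w = maxn n N by rewrite size_mkseq.
  have /cylF : mkseq (val (restart_point w Xx)) n = mkseq (val y) n.
    apply: (mkseq_le (leq_maxl n N)); rewrite -{1}sw; exact: restart_prefix.
  have /[swap]/[apply] : nbhs (restart_point w Xx) [set z : spelled_space |
      mkseq (val z) (size w).+1 = rcons w (inr ([::], inl true, 0))].
    apply/nbhs_cylinder; exists (size w).+1 => z e /=.
    by rewrite e; exact: mkseq_restart.
  move=> [z [/= zF]]; rewrite mkseqS => /rcons_inj[_ zw].
  have [|b] := zF (size w); first by rewrite sw leq_maxr.
  by rewrite zw.
apply/seteqP; split=> // y _.
have [z Xz [N [_ yN]]] := set_valP y.
exists N => // n Nn; rewrite -(subnKC Nn); eexists; exact: yN.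
Qed.

End Space.

(** * Homogeneity of the space of spelled sequences *)

Lemma ex_picks_points (R : realType) (X : set (nat -> bool))
    (D : set (spelled_space R X)) :
  ~ countable X -> countable D -> dense D ->
  exists pick, picks_points X [set val d | d in D] pick.
Proof.
move=> Xunc Dcount.
have X0 : X !=set0.
  by apply/set0P/negP => /eqP X0; apply: Xunc; rewrite X0; exact: countable0.
move=> /(dense_prefix X0) Ddense.
pose D' := [set val d | d in D].
have D'count : countable D' by exact: countable_image.
suff /boolp.choice[p pP] (cw : bool * seq letter) : exists d,
    [/\ mkseq d (size cw.2) = cw.2, spelled X d & D' d <-> cw.1].
  by exists (fun c w => p (c, w)) => c w; exact: (pP (c, w)).
case: cw => -[] w /=.
  have [d Dd dw] := Ddense w; exists (val d); split=> //; first exact: set_valP.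
  by split=> // _; exists d.
(* A countable [D] cannot contain all restarts of [w], one for each point of the uncountable [X]. *)
apply: contrapT => /forallNP noD; apply: Xunc.
apply: sub_countable D'count; apply: (@set_inj_card_le _ _ _ _ (restart w));
  last by move=> x x' _ _ /restart_inj.
move=> x Xx; apply: contrapT => nD; apply: (noD (restart w x)); split.
- exact: restart_prefix.
- exact: restart_spelled.
- by split=> // /nD.
Qed.

Lemma spelled_space_cdh (R : realType) (X : set cantor_space) :
  lambda_set X -> ~ countable X ->
  countable_dense_homogeneous (spelled_space R X).
Proof.
move=> lambdaX Xunc.
have X0 : X !=set0.
  by apply/set0P/negP => /eqP X0; apply: Xunc; rewrite X0; exact: countable0.
split=> [|D E Dcount Ddense Ecount Edense]; first exact: spelled_space_separable.
have [pick pickD] := ex_picks_points Xunc Dcount Ddense.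
have [pick' pickE] := ex_picks_points Xunc Ecount Edense.
pose D' := [set val d | d in D].
pose E' := [set val e | e in E].
pose N : set cantor_space := [set x | exists2 d, (D' `|` E') d & spells d x].
have spelledDE d : (D' `|` E') d -> spelled X d.
  by move=> [[d' _ <-]|[d' _ <-]]; exact: set_valP.
have NX : N `<=` X.
  by move=> x [d /spelledDE[x' Xx' sx'] sx]; rewrite (spells_inj sx sx').
have Ncount : countable N.
  (* A sequence spells at most one point, so the image of the countable set of elements of [D] and
     [E] under [h] covers [N]. *)
  have /boolp.choice[h hP] (d : nat -> letter) : exists x,
      (exists x', spells d x') -> spells d x.
    have [[x dx]|] := pselect (exists x, spells d x); first by exists x.
    by exists (fun=> true).
  apply: (@sub_countable _ _ _ (h @` (D' `|` E'))).
    apply: subset_card_le => x [d DEd dx]; exists d => //.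
    exact: (spells_inj (hP d (ex_intro _ x dx)) dx).
  by apply: countable_image; apply: countableU; exact: countable_image.
have [G [O Oopen ->] NG] := lambdaX N NX Ncount.
have /countable_injP[e einj] := Ncount.
pose enum k : option (nat -> bool) :=
  if pselect (exists x, N x /\ e x = k) is left h then Some (projT1 (cid h))
  else None.
have enumP k x : enum k = Some x -> N x /\ e x = k.
  by rewrite /enum; case: pselect => // h [<-]; exact: projT2 (cid h).
have enumE x : N x -> enum (e x) = Some x.
  move=> Nx; case Ex : (enum (e x)) => [x'|].
    have [Nx' ex'] := enumP _ _ Ex.
    by rewrite (einj x' x) ?inE.
  by move: Ex; rewrite /enum; case: pselect => // -[]; exists x.
(* Odd indices carry the points of [N] as singletons, or the empty set for numbers outside the
   enumeration; even indices carry the complements of the sets [O i], which are closed and disjoint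
   from [N]. *)
pose single k := if odd k then enum k./2 else None.
pose F k : set (nat -> bool) :=
  if single k is Some x then [set x] else if odd k then set0 else ~` O k./2.
have F_single k x : single k = Some x -> F k = [set x] /\ X x.
  move=> kx; rewrite /F kx; split=> //; apply: NX.
  by move: kx; rewrite /single; case: odd => // /enumP[].
have F_cover x : X x -> exists k, F k x.
  move=> Xx; have [Nx|nNx] := pselect (N x).
    exists (e x).*2.+1; rewrite /F /single /= odd_double /= uphalf_double.
    by rewrite enumE.
  have [i nOi] : exists i, ~ O i x.
    apply: contrapT => /forallNP allO; apply: nNx; rewrite NG; split=> // i _.
    exact: contrapT.
  by exists i.*2; rewrite /F /single odd_double doubleK.
have F_closed k x : (forall n, hits F k (mkseq x n)) -> F k x.
  move=> hit; have hitx n : exists2 z, F k z & mkseq z n = mkseq x n.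
    by have /asboolP[z] := hit n; rewrite size_mkseq; exists z.
  move: hitx; rewrite /F; case: (single k) => [x'|] hitx.
    by apply: eq_mkseqT => n; have [z /= ->] := hitx n.
  case: ifP hitx => [_ /(_ 0)[]//|_] hitx Ox.
  have [n xO] := cantor_open_cylinder (Oopen _) Ox.
  by have [z nO /xO] := hitx n.
have F_misses k x d : single k = None -> F k x -> (D' `|` E') d -> ~ spells d x.
  rewrite /F => -> /=; case: ifP => // _ nOx DEd dx.
  have : N x by exists d.
  by rewrite NG => -[_ /(_ k./2 I)].
have missD : misses F single D'.
  by move=> k x d ks Fx Dd; apply: F_misses ks Fx _; left.
have missE : misses F single E'.
  by move=> k x d ks Fx Ed; apply: F_misses ks Fx _; right.
have [f [g [fK gK fpre gpre [fDE gX]]]] :=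
  ex_isometry F_closed F_cover F_single pickD pickE missD missE.
pose f' (y : spelled_space R X) : spelled_space R X :=
  SigSub (mem_set (fDE _ (set_valP y)).1).
pose g' (y : spelled_space R X) : spelled_space R X :=
  SigSub (mem_set (gX _ (set_valP y))).
have f'K : cancel f' g' by move=> y; apply/val_inj/fK.
have g'K : cancel g' f' by move=> y; apply/val_inj/gK.
have DE' y : D y <-> E (f' y).
  have memval (A : set (spelled_space R X)) z : [set val a | a in A] (val z) <-> A z.
    by split=> [[a Aa /val_inj <-]|Az] //; exists z.
  rewrite -(memval D) -(memval E).
  exact: (fDE _ (set_valP y)).2.
exists f'.
  by exists g'; split=> //; apply: continuous_prefix => y z n;
    [exact: fpre|exact: gpre].
apply/seteqP; split=> [_ [y /DE' Ey <-]//|y Ey].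
by exists (g' y); rewrite ?g'K // DE' g'K.
Qed.

(** * Cardinality of the space of spelled sequences *)

(* By Zorn's lemma an infinite set is, up to a finite remainder, a disjoint
   union of countably infinite sets. *)
Lemma card_setX_nat_le T (K : set T) : infinite_set K ->
  K `*` [set: nat] #<= K.
Proof.
elim/Ppointed: T => T in K *; first by rewrite emptyE => /(_ (finite_set0 _)).
move=> Kinf.
pose D := [set i : nat -> T | set_fun setT K i /\ set_inj setT i].
have [J [JD Jdisj Jmax]] :=
  ex_maximal_disjoint_subcollection (fun i : nat -> T => range i) D.
pose U := \bigcup_(i in J) range i.
(* An infinite remainder would contain the range of a further injective sequence, against the
   maximality of [J]. *)
have rest_fin : finite_set (K `\` U).
  apply: contrapT => /infiniteP/pcard_leP/injfunPex[i iKU iinj].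
  apply: (Jmax (J `|` [set i])).
  - split=> [j|Ji]; first by left.
    have := iKU 0 I; move=> [_]; apply; exists i; last by exists 0.
    by apply: Ji; right.
  - move=> j [/JD//|->]; split=> // n _; exact: (iKU n I).1.
  - have disj j : J j -> range i `&` range j !=set0 -> False.
      move=> Jj [x [[n _ <-] jn]]; apply: (iKU n I).2; by exists j.
    move=> j j' [Jj|->] [Jj'|->] //; first exact: Jdisj.
      by rewrite setIC => /disj.
    by move=> /disj.
have /countable_injP[e einj] := finite_set_countable rest_fin.
have [i0 Ji0] : J !=set0.
  apply/set0P/negP => /eqP J0; apply: Kinf; move: rest_fin.
  by rewrite /U J0 bigcup_set0 setD0.
(* A point of [U] is coded by its sequence and its position there; the remainder is lodged in [i0]
   under a second tag. Tag, number and [m] together then give a new position along the sequence. *)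
have /boolp.choice[code codeP] x : exists c : (nat -> T) * (nat + nat), K x ->
    J c.1 /\ match c.2 with
      | inl n => c.1 n = x
      | inr n => [/\ ~ U x, c.1 = i0 & e x = n] end.
  have [Kx|] := pselect (K x); last by exists (i0, inl 0).
  have [[i Ji [n _ <-]]|nUx] := pselect (U x); first by exists (i, inl n).
  by exists (i0, inr (e x)).
pose f (p : T * nat) := (code p.1).1 (choice.pickle ((code p.1).2, p.2)).
apply: (@set_inj_card_le _ _ _ _ f).
  move=> [x m] [/= Kx _]; have [Jc _] := codeP _ Kx.
  exact: (JD _ Jc).1.
move=> [x m] [x' m']; rewrite !inE => -[/= Kx _] [/= Kx' _]; rewrite /f /=.
have [Jc cx] := codeP _ Kx; have [Jc' cx'] := codeP _ Kx'.
move=> ff; have cc : (code x).1 = (code x').1.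
  apply: Jdisj => //; exists (f (x, m)); split; first by eexists.
  by rewrite /f /= ff; eexists.
move: ff; rewrite cc => /((JD _ Jc').2 _ _ (mem_setT _) (mem_setT _)).
move=> /(pcan_inj choice.pickleK)[ss ->]; congr pair.
move: cx cx'; rewrite ss cc; case: (code x').2 => n; first by move=> -> .
move=> [nUx _ ex] [nUx' _ ex']; apply: einj; rewrite ?inE //.
by rewrite ex ex'.
Qed.

(** Words are countable, so an element of the space is coded by a point of [X] and a number;
    conversely [restart] embeds [X]. *)
Lemma card_spelled_space (R : realType) (X : set (nat -> bool)) :
  infinite_set X -> [set: spelled_space R X] #= X.
Proof.
move=> Xinf; rewrite card_eq_le; apply/andP; split; last first.
  apply: (@card_le_trans _ _ _ (spelled X)); last first.
    by have := card_setT (spelled X); rewrite card_eq_le => /andP[].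
  apply: (@set_inj_card_le _ _ _ _ (restart [::])).
    by move=> x; exact: restart_spelled.
  by move=> x x' _ _ /restart_inj.
apply: card_le_trans (card_setX_nat_le Xinf).
have /boolp.choice[c cP] (y : spelled_space R X) :
  exists c : (nat -> bool) * seq letter,
    X c.1 /\ val y = bits_tail c.2 c.1.
  have [x Xx [N sN]] := set_valP y.
  by exists (x, mkseq (val y) N); split=> //; exact: eq_bits_tail.
apply: (@set_inj_card_le _ _ _ _
  (fun y => ((c y).1, choice.pickle (c y).2))).
  by move=> y _; split=> //=; have [] := cP y.
move=> y z _ _ [c1 /(pcan_inj choice.pickleK) c2]; apply/val_inj.
by have [_ ->] := cP y; have [_ ->] := cP z; rewrite c1 c2.
Qed.

(** * From meager homogeneous metric spaces to lambda-sets *)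

Section Meager.
Context (R : realType) (M : metricType R).

Definition countable_base (U : nat -> set M) :=
  (forall n, open (U n)) /\
  forall x O, nbhs x O -> exists2 n, U n x & U n `<=` O.

Lemma metric_ball_open (x : M) (e : R) : open (ball x e).
Proof.
rewrite openE => y; rewrite ballEmdist /= => xy.
apply/nbhs_ballP; exists (e - mdist x y)%R; rewrite /= ?subr_gt0 //.
move=> z; rewrite !ballEmdist /= ltrBrDl.
exact: le_lt_trans (metric_triangle _ _ _).
Qed.

Lemma separable_countable_base : separable M -> exists U, countable_base U.
Proof.
move=> [S /countable_injP[e einj] Sdense].
pose r k : R := (k.+1%:R^-1)%R.
have r0 k : (0 < r k)%R by rewrite invr_gt0 ltr0n.
exists (fun n => [set x | exists s k,
  [/\ S s, n = choice.pickle (e s, k) & ball s (r k) x]]).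
split=> [n|x O].
  rewrite openE => x [s [k [Ss -> sx]]].
  apply: filterS (open_nbhs_nbhs (conj (@metric_ball_open s (r k)) sx)) => y sy.
  by exists s, k.
move=> /nbhs_ballP[d /= d0 xdO].
have [k kd] : exists k, (r k < d / 2)%R.
  by apply: ex_invS_lt; rewrite divr_gt0.
have [|s [xs Ss]] := Sdense (ball x (r k)) _ (@metric_ball_open x (r k)).
  by exists x; exact: ballxx.
exists (choice.pickle (e s, k)); first by exists s, k; split=> //; exact: ball_sym.
move=> y [s' [k' [Ss' /(pcan_inj choice.pickleK)[es <-] sy]]]; apply: xdO.
have ss' : s = s' by apply: einj; rewrite ?inE.
rewrite -ss' in sy; apply: (@ball_split _ _ s); apply: le_ball (ltW kd) _ _ => //.
Qed.

Lemma avoid_nowhere_dense (F : nat -> set M) n (U : set M) :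
  (forall m, nowhere_dense (F m)) -> open U -> U !=set0 ->
  exists2 x, U x & forall m, m < n -> ~ closure (F m) x.
Proof.
move=> Fnd Uo U0.
(* The induction carries an open set, since a single point could lie in the closure of the next
   piece. *)
suff [V [VU Vo [x Vx] VF]] : exists V, [/\ V `<=` U, open V, V !=set0 &
    forall m, m < n -> forall x, V x -> ~ closure (F m) x].
  by exists x; [exact: VU|move=> m mn; exact: (VF m mn x Vx)].
elim: n => [|n [V [VU Vo V0 VF]]]; first by exists U; split=> // m; rewrite ltn0.
exists (V `&` ~` closure (F n)); split.
- by move=> x [/VU].
- by apply: openI => //; apply: closed_openC; exact: closed_closure.
- apply: contrapT => /forallNP VFn; case: V0 => x Vx.
  have : interior (closure (F n)) x.
    apply: filterS (open_nbhs_nbhs (conj Vo Vx)) => y Vy.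
    by apply: contrapT => nFy; apply: (VFn y).
  by rewrite (Fnd n).
- move=> m; rewrite ltnS leq_eqVlt => /predU1P[->|mn] x [Vx nFx] //.
  exact: (VF m mn x Vx).
Qed.

(** The term [d c] lies outside the closures of [F 0] to [F c], so the closure of [F m] contains at
    most the first [m] terms. *)
Lemma meager_Gdelta_dense : separable M -> [set: M] !=set0 -> meager_in_itself M ->
  exists D : set M, [/\ countable D, dense D & Gdelta D].
Proof.
move=> /separable_countable_base[U [Uo Ubase]] M0 [F Fnd Fcover].
have /boolp.choice[d dP] c : exists d, (U c !=set0 -> U c d) /\
    forall m, m <= c -> ~ closure (F m) d.
  have [Uc0|nUc0] := pselect (U c !=set0).
    by have [d Ud dF] := avoid_nowhere_dense c.+1 Fnd (Uo c) Uc0; exists d.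
  by have [d _ dF] := avoid_nowhere_dense c.+1 Fnd (@openT M) M0; exists d.
exists (range d); split.
- exact: countable_image.
- move=> O [x Ox] Oo.
  have [c Ux UO] := Ubase _ _ (open_nbhs_nbhs (conj Oo Ox)).
  exists (d c); split; last by exists c.
  by apply: UO; apply: (dP c).1; exists x.
pose r k : R := (k.+1%:R^-1)%R.
have r0 k : (0 < r k)%R by rewrite invr_gt0 ltr0n.
(* The balls readmit the first [m] terms, the only ones that the complement of the closure of [F m]
   can omit. As [k] grows they shrink and exclude every other point of [F m]. *)
pose O m k := ~` closure (F m) `|` \bigcup_(c in `I_m) ball (d c) (r k).
exists (fun n => if choice.unpickle n is Some (m, k) then O m k else setT).
  move=> n; case: choice.unpickle => [[m k]|]; last exact: openT.
  apply: openU; first by apply: closed_openC; exact: closed_closure.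
  by apply: bigcup_open => c _; exact: metric_ball_open.
apply/seteqP; split=> [_ [c _ <-] n _|x xO].
  case: choice.unpickle => // -[m k].
  have [mc|cm] := leqP m c; first by left; exact: (dP c).2.
  by right; exists c => //; exact: ballxx.
have [m _ Fx] : (\bigcup_n F n) x by rewrite -Fcover.
apply: contrapT => nx.
have [k kfar] : exists k, forall c, c < m -> ~ ball (d c) (r k) x.
  elim: (m) => [|m' [k IHk]]; first by exists 0.
  have xd : (0 < mdist (d m') x)%R.
    by rewrite mdist_gt0; apply/eqP => e; apply: nx; exists m'.
  have [k' kd] : exists k, (r k < mdist (d m') x)%R by exact: ex_invS_lt.
  have rle i j : (i <= j)%N -> (r j <= r i)%R.
    by move=> ij; rewrite lef_pV2 ?posrE ?ltr0n // ler_nat.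
  exists (maxn k k') => c; rewrite ltnS leq_eqVlt => /predU1P[->|cm].
    rewrite ballEmdist /=; apply/negP; rewrite -leNgt.
    by apply: le_trans (ltW kd); apply: rle; rewrite leq_maxr.
  move=> /(le_ball (rle _ _ (leq_maxl k k'))); exact: IHk.
have := xO (choice.pickle (m, k)) I; rewrite choice.pickleK.
move=> [|[c /= cm]]; last exact: kfar.
by apply; exact: subset_closure.
Qed.

(** Adding a countable dense [Gdelta] set [D] makes [A] dense, and a homeomorphism carries [D] onto
    the union [B]. The countably many points of [B] outside [A] are then removed one by one,
    singletons being closed. *)
Lemma cdh_countable_Gdelta (A : set M) : meager_in_itself M ->
  countable_dense_homogeneous M -> countable A -> Gdelta A.
Proof.
move=> Mmeager [Msep Mcdh] Acount.
have [M0|M0] := pselect ([set: M] !=set0); last first.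
  exists (fun=> setT) => [_|]; first exact: openT.
  by apply/seteqP; split=> x //; case: M0; exists x.
have [D [Dcount Ddense [O Oo DO]]] := meager_Gdelta_dense Msep M0 Mmeager.
pose B := A `|` D.
have Bcount : countable B.
  exact: countableU.
have Bdense : dense B.
  move=> V V0 Vo; have [x [Vx Dx]] := Ddense V V0 Vo.
  by exists x; split=> //; right.
have [f [g [fK gK _ gcont]] fD] := Mcdh D B Dcount Ddense Bcount Bdense.
have BE x : B x <-> D (g x).
  rewrite -fD; split=> [[y Dy <-]|Dgx]; first by rewrite fK.
  by exists (g x).
have /countable_injP[e einj] := Bcount.
have closed_fibre n : closed [set x | (B `\` A) x /\ e x = n].
  have [[x [Bx ex]]|none] := pselect ([set x | (B `\` A) x /\ e x = n] !=set0).
    rewrite (_ : mkset _ = [set x]).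
      exact: (accessible_closed_set1 (hausdorff_accessible (@metric_hausdorff _ M))).
    apply/seteqP; split=> [y [By ey]|_ ->] //=.
    by apply: einj; rewrite ?inE ?ey //; [case: By|case: Bx].
  rewrite (_ : mkset _ = set0); first exact: closed0.
  by rewrite -subset0 => x Bx; apply: none; exists x.
exists (fun n => g @^-1` O n `&` ~` [set x | (B `\` A) x /\ e x = n]).
  move=> n; apply: openI; last exact: closed_openC.
  by move/continuousP: gcont; apply.
apply/seteqP; split=> [x Ax n _|x xG].
  split=> [|[[_ nAx]]//].
  have /BE : B x by left.
  by rewrite DO; apply.
apply: contrapT => nAx; have Bx : B x.
  by apply/BE; rewrite DO => n _; case: (xG n I).
by case: (xG (e x) I) => _; apply.
Qed.

Lemma countable_Gdelta_lambda : separable M ->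
  (forall A : set M, countable A -> Gdelta A) ->
  exists2 X : set cantor_space, lambda_set X & X #= [set: M].
Proof.
move=> /separable_countable_base[U [Uo Ubase]] countG.
pose h (x : M) : cantor_space := fun n => `[< U n x >].
have hinj : injective h.
  move=> x y hxy; apply: contrapT => nxy.
  have : nbhs x (~` [set y]).
    apply: open_nbhs_nbhs; split=> //; apply: closed_openC.
    exact: (accessible_closed_set1 (hausdorff_accessible (@metric_hausdorff _ M))).
  move=> /Ubase[n Ux /(_ y)]; apply => //.
  by apply/asboolP; rewrite -[asbool _]/(h y n) -hxy; apply/asboolP.
exists (range h); last exact: (inj_card_eq (in2W hinj)).
move=> A Ah Acount.
have [|O Oo hO] := countG (h @^-1` A).
  apply: sub_countable Acount; apply: (@set_inj_card_le _ _ _ _ h) => //.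
  by move=> x y _ _ /hinj.
(* For open [V], this open set meets the range of [h] exactly in the image of [V]. *)
pose W V : set cantor_space := [set z | exists2 n, z n & U n `<=` V].
have Wh V x : open V -> W V (h x) <-> V x.
  move=> Vo; split=> [[n /asboolP Ux UV]|Vx]; first exact: UV.
  have [n Ux UV] := Ubase _ _ (open_nbhs_nbhs (conj Vo Vx)).
  by exists n => //; apply/asboolP.
exists (\bigcap_i W (O i)).
  exists (fun i => W (O i)) => // i.
  rewrite (_ : W _ = \bigcup_(n in [set n | U n `<=` O i])
    (fun z : cantor_space => z n) @^-1` [set true]).
    apply: bigcup_open => n _; apply: open_comp; last exact: discrete_open.
    by move=> z _; exact: (@proj_continuous nat (fun=> bool)).
  by apply/seteqP; split=> [z [n zn UO]|z [n UO zn]]; exists n.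
apply/seteqP; split=> [z Az|_ [[x _ <-] Wx]].
  have [x _ xz] := Ah _ Az; split=> [|i _]; first by exists x.
  rewrite -xz; apply/Wh => //.
  have : (h @^-1` A) x by rewrite /= xz.
  by rewrite hO; apply.
suff : (h @^-1` A) x by [].
by rewrite hO => i _; apply/Wh => //; exact: Wx.
Qed.

End Meager.

(* The cardinal kappa is represented by a set K with kappa elements. *)
Theorem corollary4p2 (R : realType) (T : Type) (K : set T)
    (K_uncountable : ~ countable K)
    (K_le_continuum : K #<= [set: cantor_space]) :
  (exists X : metricType R,
      [/\ meager_in_itself X, countable_dense_homogeneous X & [set: X] #= K])
  <->
  (exists2 X : set cantor_space, lambda_set X & X #= K).
Proof.
split=> [[M [Mmeager Mcdh MK]]|[X Xlambda XK]].
  have [X Xlambda XM] := countable_Gdelta_lambda Mcdh.1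
    (fun A => @cdh_countable_Gdelta _ _ A Mmeager Mcdh).
  by exists X => //; exact: card_eq_trans XM MK.
have Xunc : ~ countable X by rewrite (eq_countable XK).
have Xinf : infinite_set X by move=> /finite_set_countable.
exists (spelled_space R X); split.
- exact/spelled_space_meager/infinite_setN0.
- exact: spelled_space_cdh.
- exact: card_eq_trans (card_spelled_space R Xinf) XK.
Qed.
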